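(* Let $\mathcal{X}$ be a finite non-empty set. Consider a path $\omega\in\mathcal{X}^{\mathbb{N}}$, a gamble $f\in\mathcal{L}(\mathcal{X})$ and a closed interval $I$. Then $I\in\mathcal{I}_f(\omega)$ if and only if $\min I\in L_f(\omega)$ and $\max I\in U_f(\omega)$.
   Context: A gamble is a map $f:\mathcal{X}\to\mathbb{R}$; $\mathcal{L}(\mathcal{X})$ is the linear space of all gambles. A coherent lower expectation is a map $\underline{E}:\mathcal{L}(\mathcal{X})\to\mathbb{R}$ such that for all $f,g\in\mathcal{L}(\mathcal{X})$ and real $\alpha\ge 0$: $\min f\le\underline{E}(f)$; $\underline{E}(\alpha f)=\alpha\underline{E}(f)$; $\underline{E}(f)+\underline{E}(g)\le\underline{E}(f+g)$. Its conjugate upper expectation is $\overline{E}(f):=-\underline{E}(-f)$. Situations are the finite sequences $s=x_{1:n}=(x_1,\dots,x_n)\in\mathbb{S}:=\bigcup_{n\in\mathbb{N}_0}\mathcal{X}^n$, with $\square$ the empty sequence; $sx$ is the concatenation of $s\in\mathbb{S}$ and $x\in\mathcal{X}$. For a path $\omega=(x_1,x_2,\dots)\in\mathcal{X}^{\mathbb{N}}$, $\omega^n:=(x_1,\dots,x_n)$ for $n\in\mathbb{N}_0$. A real process is a map $F:\mathbb{S}\to\mathbb{R}$; its process difference is the gamble $\Delta F(s)$ given by $\Delta F(s)(x):=F(sx)-F(s)$. A net of rationals $\{r_{s,n}\}_{s\in\mathbb{S},n\in\mathbb{N}_0}$ is recursive if $r_{s,n}=(-1)^{\sigma(s,n)}a(s,n)/b(s,n)$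 for some recursive (Turing-computable) maps $a,b,\sigma:\mathbb{S}\times\mathbb{N}_0\to\mathbb{N}_0$ with $b$ nowhere zero. A real process $F$ is computable if there is a recursive net of rationals $\{r_{s,n}\}$ with $|r_{s,n}-F(s)|\le 2^{-N}$ for all $s\in\mathbb{S}$ and all $n\ge N$ in $\mathbb{N}_0$. A path $\omega$ is computably random for a coherent lower expectation $\underline{E}$ if there is no computable real process $M$ with $M(s)\ge 0$ and $\overline{E}(\Delta M(s))\le 0$ for all $s\in\mathbb{S}$ such that $\sup_{n\in\mathbb{N}_0}M(\omega^n)=+\infty$. Closed intervals are non-empty and bounded: $I=[\min I,\max I]$ with $\min I\le\max I$ real. A path $\omega$ is computably random for a gamble $f$ and a closed interval $I$ if there is a coherent lower expectation $\underline{E}$ for which $\omega$ is computably random and such that $\underline{E}(f)=\min I$ and $\overline{E}(f)=\max I$. $\mathcal{I}_f(\omega)$ denotes the set of all closed intervals $I$ such that $\omega$ is computably random for $f$ and $I$. Finally, $L_f(\omega):=\{\min J: J\in\mathcal{I}_f(\omega)\}$ and $U_f(\omega):=\{\max J: J\in\mathcal{I}_f(\omega)\}$. *)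

(* Defs.v *)
From HB Require Import structures.
From mathcomp Require Import all_boot all_order all_algebra.
From mathcomp Require Import boolp classical_sets reals constructive_ereal ereal.

Set Implicit Arguments.
Unset Strict Implicit.
Unset Printing Implicit Defensive.
Import Order.TTheory GRing.Theory Num.Theory.

Local Open Scope classical_set_scope.
Local Open Scope ring_scope.

(* Turing computability is rendered by Kleene's mu-recursive functions: terms  *)
(* for the k-ary partial recursive functions and their graphs.                 *)
Inductive mu_term : nat -> Type :=
| MuZero k : mu_term k
| MuSucc : mu_term 1
| MuProj k (i : 'I_k) : mu_term k
| MuComp m k (h : mu_term m) (g : 'I_m -> mu_term k) : mu_term k
| MuPrec k (h : mu_term k) (g : mu_term k.+2) : mu_term k.+1
| MuMin k (h : mu_term k.+1) : mu_term k.

(* [mu_graph t v y]: the partial function of t is defined at v with value y.   *)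
(* Primitive recursion is on the first argument v_0 (g receives the counter,   *)
(* the previous value and the parameters); minimisation also searches in the   *)
(* first argument and requires h to be defined and nonzero below the value.    *)
Fixpoint mu_graph k (t : mu_term k) : k.-tuple nat -> nat -> Prop :=
  match t in mu_term k return k.-tuple nat -> nat -> Prop with
  | MuZero _ => fun _ y => y = 0%N
  | MuSucc => fun v y => y = (thead v).+1
  | MuProj _ i => fun v y => y = tnth v i
  | MuComp m _ h g => fun v y =>
      exists2 u : m.-tuple nat,
        forall i, mu_graph (g i) v (tnth u i) & mu_graph h u y
  | MuPrec k h g => fun v =>
      let p : k.-tuple nat := [tuple of behead v] in
      let fix rec n : nat -> Prop :=
        match n with
        | 0 => mu_graph h p
        | n'.+1 => fun y =>
            exists2 z, rec n' z & mu_graph g [tuple of n' :: z :: p] y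
        end in
      rec (thead v)
  | MuMin _ h => fun v y =>
      mu_graph h [tuple of y :: v] 0%N /\
      forall z, (z < y)%N -> exists w, mu_graph h [tuple of z :: v] w.+1
  end.

(* Gödel number of a situation: bijective base-#|X| numeration, a bijection    *)
(* between seq X and nat when X is non-empty.                                  *)
Definition situation_code (X : finType) (s : seq X) : nat :=
  foldl (fun c x => (c * #|X| + enum_rank x).+1) 0%N s.

Definition recursive_map (X : finType) (a : seq X -> nat -> nat) : Prop :=
  exists t : mu_term 2,
    forall s n, mu_graph t [tuple situation_code s; n] (a s n).

Definition recursive_net (X : finType) (r : seq X -> nat -> rat) : Prop :=
  exists a b sigma : seq X -> nat -> nat,
    [/\ recursive_map a, recursive_map b, recursive_map sigma,
        forall s n, b s n <> 0%N &
        forall s n, r s n = (-1) ^+ sigma s n * ((a s n)%:R / (b s n)%:R)].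

Definition computable_process (R : realType) (X : finType) (F : seq X -> R) :
    Prop :=
  exists2 r : seq X -> nat -> rat, recursive_net r &
    forall s n N, (N <= n)%N -> `|ratr (r s n) - F s| <= 2%:R ^- N.

(* As X is finite and non-empty, the infimum of [range f] is its minimum.      *)
Record coherent (R : realType) (X : finType) (E : (X -> R) -> R) : Prop :=
  Coherent {
    coherent_min : forall f, inf (range f) <= E f;
    coherent_homogeneous :
      forall f (alpha : R), 0 <= alpha -> E (fun x => alpha * f x) = alpha * E f;
    coherent_superadditive :
      forall f g, E f + E g <= E (fun x => f x + g x) }.

Definition upper_expectation (R : realType) (X : finType)
    (E : (X -> R) -> R) (f : X -> R) : R := - E (fun x => - f x).

Definition process_difference (R : realType) (X : finType)
    (F : seq X -> R) (s : seq X) : X -> R := fun x => F (rcons s x) - F s.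

Definition computably_random (R : realType) (X : finType)
    (E : (X -> R) -> R) (w : nat -> X) : Prop :=
  ~ exists M : seq X -> R,
      [/\ computable_process M,
          forall s, 0 <= M s,
          forall s, upper_expectation E (process_difference M s) <= 0 &
          ereal_sup (range (fun n => (M (mkseq w n))%:E)) = +oo%E].

Record closed_interval (R : realType) : Type := ClosedInterval {
  imin : R;
  imax : R;
  imin_le_imax : imin <= imax }.

Definition computably_random_for (R : realType) (X : finType)
    (f : X -> R) (I : closed_interval R) (w : nat -> X) : Prop :=
  exists E : (X -> R) -> R,
    [/\ coherent E, computably_random E w,
        E f = imin I & upper_expectation E f = imax I].

Definition random_intervals (R : realType) (X : finType)
    (f : X -> R) (w : nat -> X) : set (closed_interval R) :=
  [set I | computably_random_for f I w].

Definition L_ (R : realType) (X : finType)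
    (f : X -> R) (w : nat -> X) : set R :=
  [set imin J | J in random_intervals f w].

Definition U_ (R : realType) (X : finType)
    (f : X -> R) (w : nat -> X) : set R :=
  [set imax J | J in random_intervals f w].

(* Main.v *)
Require Import Defs.
From mathcomp Require Import all_boot all_order all_algebra.
From mathcomp Require Import ring lra.
From mathcomp Require Import boolp classical_sets reals constructive_ereal ereal.

(* Let E1 and E2 make w random with E1 f = a and upper E2 f = b. The witness
   for [a, b] is the least informative E, the natural extension of these two
   bounds: if the upper E-expectation of a gamble g is at most 0, then g is
   dominated up to any e > 0 by a non-negative multiple of f - b or of a -
   f, hence its upper expectation is at most 0 for E2 or for E1. The first
   case obtains if g x > 0 for some x with f x > b, and the second
   otherwise. This test involves a finite set of outcomes only, so it is
   decidable for rational-valued g even when f, a and b are not computable.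
   Given a computable E-supermartingale M, replace it by a positive
   rational-valued majorant, and factor that majorant into the capital made
   in the situations that pass the test, an E2-supermartingale, and the
   capital made in the others, an E1-supermartingale. Both are computable,
   hence bounded along w, and so is M. *)

Set Implicit Arguments.
Unset Strict Implicit.
Unset Printing Implicit Defensive.
Import Order.TTheory GRing.Theory Num.Theory.

(** * Closure properties of total recursive functions *)

(* Arguments are read off a list with [nth 0]: only its value on lists of
   length k matters. *)
Definition recfun k (F : seq nat -> nat) : Prop :=
  exists t : mu_term k, forall v : k.-tuple nat, mu_graph t v (F v).

Lemma recfun_ext k (F G : seq nat -> nat) :
  (forall v : k.-tuple nat, F v = G v) -> recfun k F -> recfun k G.
Proof. by move=> FG [t tF]; exists t => v; rewrite -FG. Qed.

Lemma recfun_nth k i : (i < k)%N -> recfun k (nth 0%N ^~ i).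
Proof.
by move=> ik; exists (MuProj (Ordinal ik)) => v /=; rewrite (tnth_nth 0%N).
Qed.

Lemma recfun_comp m k h (G : m.-tuple (seq nat -> nat)) :
  recfun m h -> (forall i, recfun k (tnth G i)) ->
  recfun k (fun v => h [seq g v | g <- G]).
Proof.
move=> [th thP] /fin_all_exists[tg tgP]; exists (MuComp th tg) => v.
exists [tuple of [seq g (v : seq nat) | g <- G]]; last exact: thP.
by move=> i; rewrite tnth_map; exact: tgP.
Qed.

Lemma recfun_prec k h g N : recfun k h -> recfun k.+2 g -> recfun k N ->
  recfun k (fun v =>
    nat_rect (fun=> nat) (h v) (fun n z => g [:: n, z & v]) (N v)).
Proof.
move=> [th thP] [tg tgP] [tN tNP].
(* [MuPrec] recurses on its first argument, so the count [N v] is prepended to the parameters. *)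
pose arg (i : 'I_k.+1) := if unlift ord0 i is Some j then MuProj j else tN.
have precP (u : k.+1.-tuple nat) : mu_graph (MuPrec th tg) u
    (nat_rect (fun=> nat) (h (behead u)) (fun n z => g [:: n, z & behead u])
       (thead u)).
  rewrite /=; elim: (thead u) => [|n IHn].
    exact: (thP [tuple of behead u]).
  by eexists; [exact: IHn | exact: (tgP [tuple of n :: _ :: behead u])].
exists (MuComp (MuPrec th tg) arg) => v.
exists [tuple of N v :: v].
  move=> i; rewrite /arg; case: unliftP => [j|] ->; last exact: tNP.
  by rewrite /= tnthS.
exact: (precP [tuple of N v :: v]).
Qed.

(** Closure under composition at every arity, so that facts about compound expressions chain without
    handling tuples. *)
Definition recfun1 (g : nat -> nat) : Prop :=
  forall k F, recfun k F -> recfun k (fun v => g (F v)).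

Definition recfun2 (g : nat -> nat -> nat) : Prop :=
  forall k F G, recfun k F -> recfun k G -> recfun k (fun v => g (F v) (G v)).

Lemma recfun1P g : recfun 1 (fun v => g (nth 0%N v 0)) -> recfun1 g.
Proof.
move=> rg k F rF; apply: (recfun_comp (G := [tuple F]) rg) => i.
by rewrite ord1.
Qed.

Lemma recfun2P g :
  recfun 2 (fun v => g (nth 0%N v 0) (nth 0%N v 1)) -> recfun2 g.
Proof.
move=> rg k F G rF rG; apply: (recfun_comp (G := [tuple F; G]) rg).
by case=> [[|[|]]].
Qed.

Lemma recfun_cst k n : recfun k (fun=> n).
Proof.
elim: n => [|n [t tP]]; first by exists (MuZero k).
exists (MuComp MuSucc (fun=> t)) => v; exists [tuple n] => // i.
by rewrite ord1; exact: tP.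
Qed.

Lemma recfun_succ : recfun1 succn.
Proof. by apply: recfun1P; exists MuSucc => v; case/tupleP: v. Qed.

Lemma recfun_add : recfun2 addn.
Proof.
apply: recfun2P; apply: recfun_ext (recfun_prec (h := nth 0%N ^~ 1)
  (g := fun v => (nth 0%N v 1).+1) (N := nth 0%N ^~ 0) _ _ _).
- by move=> v; elim: (nth _ v 0) => //= n ->.
- exact: recfun_nth.
- exact/recfun_succ/recfun_nth.
- exact: recfun_nth.
Qed.

Lemma recfun_mul : recfun2 muln.
Proof.
(* The step function sees the counter at position 0, the previous value at 1 and the parameters from
   2 on; position 3 is the second factor. *)
apply: recfun2P; apply: recfun_ext (recfun_prec (h := fun=> 0%N)
  (g := fun v => (nth 0%N v 3 + nth 0%N v 1)%N) (N := nth 0%N ^~ 0) _ _ _).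
- by move=> v; elim: (nth _ v 0) => //= n ->.
- exact: recfun_cst.
- by apply: recfun_add; exact: recfun_nth.
- exact: recfun_nth.
Qed.

Lemma recfun_pred : recfun1 predn.
Proof.
apply: recfun1P; apply: recfun_ext (recfun_prec (h := fun=> 0%N)
  (g := nth 0%N ^~ 0) (N := nth 0%N ^~ 0) _ _ _).
- by move=> v; case: (nth _ v 0).
- exact: recfun_cst.
- exact: recfun_nth.
- exact: recfun_nth.
Qed.

Lemma recfun_sub : recfun2 subn.
Proof.
apply: recfun2P; apply: recfun_ext (recfun_prec (h := nth 0%N ^~ 0)
  (g := fun v => (nth 0%N v 1).-1) (N := nth 0%N ^~ 1) _ _ _).
- by move=> v; elim: (nth _ v 1) => [|n /= ->]; rewrite ?subn0 ?subnS.
- exact: recfun_nth.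
- exact/recfun_pred/recfun_nth.
- exact: recfun_nth.
Qed.

Lemma recfun_exp m : recfun1 (expn m).
Proof.
apply: recfun1P; apply: recfun_ext (recfun_prec (h := fun=> 1%N)
  (g := fun v => (m * nth 0%N v 1)%N) (N := nth 0%N ^~ 0) _ _ _).
- by move=> v; elim: (nth _ v 0) => // n /= ->; rewrite expnS.
- exact: recfun_cst.
- by apply: recfun_mul; [exact: recfun_cst | exact: recfun_nth].
- exact: recfun_nth.
Qed.

Lemma recfun_leq : recfun2 (fun m n => (m <= n)%N).
Proof.
move=> k F G rF rG.
apply: recfun_ext (recfun_sub (recfun_cst k 1) (recfun_sub rF rG)) => v.
by rewrite [in RHS]/leq; case: (F v - G v)%N.
Qed.

Lemma recfun_odd : recfun1 odd.
Proof.
apply: recfun1P; apply: recfun_ext (recfun_prec (h := fun=> 0%N)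
  (g := fun v => (1 - nth 0%N v 1)%N) (N := nth 0%N ^~ 0) _ _ _).
- by move=> v; elim: (nth _ v 0) => //= n ->; case: odd.
- exact: recfun_cst.
- by apply: recfun_sub; [exact: recfun_cst | exact: recfun_nth].
- exact: recfun_nth.
Qed.

Lemma recfun_if k (b : seq nat -> bool) F G :
  recfun k (fun v => b v) -> recfun k F -> recfun k G ->
  recfun k (fun v => if b v then F v else G v).
Proof.
move=> rb rF rG.
apply: recfun_ext (recfun_add (recfun_mul rb rF)
  (recfun_mul (recfun_sub (recfun_cst k 1) rb) rG)) => v.
by case: (b v); rewrite ?mul1n ?mul0n ?addn0.
Qed.

(** Recursion on the dividend: from n to n + 1 the quotient q grows by one exactly when (q + 1) * d
    <= n + 1. *)
Lemma recfun_div d : (0 < d)%N -> recfun1 (divn^~ d).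
Proof.
move=> d_gt0; apply: recfun1P; apply: recfun_ext (recfun_prec (h := fun=> 0%N)
  (g := fun v =>
    (((nth 0%N v 1).+1 * d <= (nth 0%N v 0).+1) + nth 0%N v 1)%N)
  (N := nth 0%N ^~ 0) _ _ _).
- move=> v; elim: (nth _ v 0) => [|n /= ->]; first by rewrite div0n.
  rewrite divnS// -leq_divRL// divnS//.
  by case: (d %| n.+1)%N; rewrite ?leqnn // ltnn.
- exact: recfun_cst.
- apply: recfun_add; last exact: recfun_nth.
  apply: recfun_leq; last exact/recfun_succ/recfun_nth.
  by apply: recfun_mul; [exact/recfun_succ/recfun_nth | exact: recfun_cst].
- exact: recfun_nth.
Qed.

Lemma recfun_iter g : recfun1 g -> recfun2 (fun n x => iter n g x).
Proof.
move=> rg; apply: recfun2P; apply: recfun_ext (recfun_prec (h := nth 0%N ^~ 1)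
  (g := fun v => g (nth 0%N v 1)) (N := nth 0%N ^~ 0) _ _ _).
- by move=> v; elim: (nth _ v 0) => //= n ->.
- exact: recfun_nth.
- exact/rg/recfun_nth.
- exact: recfun_nth.
Qed.

Lemma recfun_prod g : recfun2 g ->
  recfun2 (fun n x => \prod_(k < n) g k x)%N.
Proof.
move=> rg; apply: recfun2P; apply: recfun_ext (recfun_prec (h := fun=> 1%N)
  (g := fun v => (nth 0%N v 1 * g (nth 0%N v 0) (nth 0%N v 3))%N)
  (N := nth 0%N ^~ 0) _ _ _).
- move=> v; elim: (nth _ v 0) => [|n /= ->]; first by rewrite big_ord0.
  by rewrite big_ord_recr.
- exact: recfun_cst.
- apply: recfun_mul; first exact: recfun_nth.
  by apply: rg; exact: recfun_nth.
- exact: recfun_nth.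
Qed.

(** The list is a constant of the program, which unfolds into nested conditionals. It may thus be
    chosen non-effectively, as with the outcomes x such that b < f x. *)
Lemma recfun_has (T : Type) (P : T -> nat -> bool) (l : seq T) :
  (forall i, recfun1 (fun x => P i x)) -> recfun1 (fun x => has (P^~ x) l).
Proof.
move=> rP k F rF; elim: l => [|i l IHl]; first exact: recfun_cst.
apply: recfun_ext (recfun_if (b := fun v => P i (F v)) (rP i _ _ rF)
  (recfun_cst k 1) IHl) => v /=.
by case: (P i (F v)).
Qed.

Local Open Scope classical_set_scope.
Local Open Scope ring_scope.

(** * Computable processes *)

(** Removal of the last outcome, on codes. Since [0.-1] is 0, the root is its own parent. *)
Definition parent (X : finType) (c : nat) : nat := (c.-1 %/ #|X|)%N.

Lemma situation_code_rcons (X : finType) (s : seq X) x :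
  situation_code (rcons s x) = (situation_code s * #|X| + enum_rank x).+1.
Proof. by rewrite /situation_code -cats1 foldl_cat. Qed.

Lemma parent_rcons (X : finType) (s : seq X) x :
  parent X (situation_code (rcons s x)) = situation_code s.
Proof.
have X_gt0 : (0 < #|X|)%N by apply/card_gt0P; exists x.
by rewrite situation_code_rcons /parent divnMDl// divn_small ?addn0// ltn_ord.
Qed.

Lemma situation_code_inj (X : finType) : injective (@situation_code X).
Proof.
elim/last_ind=> [|s x IHs] t; case/lastP: t => [|t y] //.
- by rewrite situation_code_rcons.
- by rewrite situation_code_rcons.
move=> eq_code; have := congr1 (parent X) eq_code.
rewrite !parent_rcons => /IHs eq_st; move: eq_code.
rewrite !situation_code_rcons eq_st => -[] /addnI eq_xy.
by congr rcons; apply: enum_rank_inj; exact: val_inj.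
Qed.

Lemma situation_code_surj (X : finType) (X_gt0 : (0 < #|X|)%N) c :
  exists s : seq X, situation_code s = c.
Proof.
elim/ltn_ind: c => -[|c] IHc; first by exists [::].
have [|s sc] := IHc (c %/ #|X|)%N; first by rewrite ltnS leq_div.
exists (rcons s (enum_val (Ordinal (ltn_pmod c X_gt0)))).
by rewrite situation_code_rcons sc enum_valK /= -divn_eq.
Qed.

(** A decoder obtained by choice turns [a] into a map on codes; the term [t], which already reads
    codes, computes that map. *)
Lemma recursive_map_recfun (X : finType) (a : seq X -> nat -> nat) :
  (0 < #|X|)%N -> recursive_map a ->
  exists2 g, recfun2 g & forall s n, a s n = g (situation_code s) n.
Proof.
move=> X_gt0 [t tP].
have [dec decP] := choice (situation_code_surj X_gt0).
exists (fun c n => a (dec c) n); last first.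
  by move=> s n; congr a; apply: situation_code_inj; rewrite decP.
apply: recfun2P; exists t => v.
case/tupleP: v => x v; case/tupleP: v => y v; rewrite tuple0 /=.
have := tP (dec x) y; rewrite decP; congr (mu_graph t _ _).
Qed.

Lemma recfun_recursive_map (X : finType) g :
  recfun1 g -> recursive_map (fun (s : seq X) (_ : nat) => g (situation_code s)).
Proof.
move=> rg; have [t tP] := rg _ _ (recfun_nth (isT : 0 < 2)%N).
by exists t => s n; exact: (tP [tuple situation_code s; n]).
Qed.

Lemma computable_process_ratio (R : realType) (X : finType) N D :
  recfun1 N -> recfun1 D -> (forall c, 0 < D c)%N ->
  computable_process (fun s : seq X =>
    (N (situation_code s))%:R / (D (situation_code s))%:R : R).
Proof.
move=> rN rD D_gt0.
exists (fun s _ => (N (situation_code s))%:R / (D (situation_code s))%:R).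
  exists (fun s _ => N (situation_code s)), (fun s _ => D (situation_code s)).
  exists (fun _ _ => 0%N); split=> [||||s n].
  - exact: recfun_recursive_map.
  - exact: recfun_recursive_map.
  - by apply: (@recfun_recursive_map X (fun=> 0%N)) => k F _; exact: recfun_cst.
  - by move=> s _; apply/eqP; rewrite -lt0n.
  - by rewrite expr0 mul1r.
move=> s n k _; rewrite fmorph_div /= !ratr_nat subrr normr0.
by rewrite invr_ge0 exprn_ge0.
Qed.

(* The margin at s is at least 2^-c(s), with c(s) the code of s, and at most
   twice that. As c(sx) > c(s) it does not increase along a path. *)
Lemma rational_majorant (R : realType) (X : finType) (F : seq X -> R) :
  (0 < #|X|)%N -> computable_process F -> (forall s, 0 <= F s) ->
  exists N D, [/\ recfun1 N, recfun1 D, forall c, (0 < D c)%N &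
    forall s c, c = situation_code s ->
      F s + 2 ^- c <= (N c)%:R / (D c)%:R <= F s + 2 * 2 ^- c].
Proof.
move=> X_gt0 [r [a [b [sg [ra rb rsg b_neq0 rE]]]] rF] F_ge0.
have [A rA aE] := recursive_map_recfun X_gt0 ra.
have [B rB bE] := recursive_map_recfun X_gt0 rb.
have [S rS sgE] := recursive_map_recfun X_gt0 rsg.
have B_gt0 c : (0 < B c c.+1)%N.
  have [s <-] := situation_code_surj X_gt0 c.
  by rewrite -bE lt0n; apply/eqP.
(* The quotient is r + 3 * 2^-(c+1), where r is the approximation of index c + 1. As r is within
   2^-(c+1) of F s, the margin lies between 2 and 4 times 2^-(c+1). *)
exists (fun c => if odd (S c c.+1) then 3 * B c c.+1 - A c c.+1 * 2 ^ c.+1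
                 else 3 * B c c.+1 + A c c.+1 * 2 ^ c.+1)%N.
exists (fun c => B c c.+1 * 2 ^ c.+1)%N; split.
- move=> k G rG; have rG1 := recfun_succ rG.
  apply: recfun_if; first by apply: recfun_odd; exact: rS.
    apply: recfun_sub; apply: recfun_mul; [exact: recfun_cst|exact: rB|exact: rA|].
    exact: recfun_exp.
  apply: recfun_add; apply: recfun_mul; [exact: recfun_cst|exact: rB|exact: rA|].
  exact: recfun_exp.
- move=> k G rG; have rG1 := recfun_succ rG.
  by apply: recfun_mul; [exact: rB | exact: recfun_exp].
- by move=> c; rewrite muln_gt0 B_gt0 expn_gt0.
move=> s c cE; have := rF s c.+1 c.+1 (leqnn _).
rewrite rE aE bE sgE -cE rmorphM /= rmorphXn rmorphN1 fmorph_div /= !ratr_nat.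
rewrite -signr_odd ler_norml.
have B0 : 0 < (B c c.+1)%:R :> R by rewrite ltr0n.
have p0 : 0 < 2 ^+ c.+1 :> R by rewrite exprn_gt0.
have -> : 2 ^- c = 2 * 2 ^- c.+1 :> R.
  by rewrite exprS invfM mulrA mulfV ?mul1r// pnatr_eq0.
move: (F_ge0 s) p0 B0; rewrite natrM natrX.
move: (F s) => Fs; move E : (2 ^+ c.+1 : R) => p F0 p0 B0.
have ip0 : 0 < p^-1 by rewrite invr_gt0.
case: odd => /andP[lo hi].
  rewrite expr1 mulN1r in lo hi.
  (* The truncated subtraction is exact: F s >= 0 forces a negative approximation to be at least
     -2^-(c+1). *)
  have le3 : (A c c.+1 * 2 ^ c.+1 <= 3 * B c c.+1)%N.
    rewrite -(ler_nat R) !natrM natrX E -ler_pdivrMr// mulrAC -ler_pdivlMr//.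
    by lra.
  rewrite natrB// !natrM natrX E.
  rewrite (_ : _ / (_ * _) = 3 * p^-1 - (A c c.+1)%:R / (B c c.+1)%:R).
  by apply/andP; split; lra.
  by field; rewrite !gt_eqF.
rewrite expr0 mul1r in lo hi.
rewrite natrD !natrM natrX E.
rewrite (_ : _ / (_ * _) = 3 * p^-1 + (A c c.+1)%:R / (B c c.+1)%:R).
  by apply/andP; split; lra.
by field; rewrite !gt_eqF.
Qed.

Definition growth_factor (K : fieldType) (X : finType) (S : pred nat)
    (Q : nat -> K) (c : nat) : K :=
  if (0 < c)%N && S (parent X c) then Q c / Q (parent X c) else 1.

(* The capital obtained by following the strategy that underlies Q in the
   situations selected by S only. The length of s is at most its code, and
   the superfluous factors are 1 as the root is its own parent. *)
Definition selected_capital (K : fieldType) (X : finType) (S : pred nat)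
    (Q : nat -> K) (s : seq X) : K :=
  \prod_(k < situation_code s)
    growth_factor X S Q (iter k (parent X) (situation_code s)).

Lemma iter_parent (X : finType) k c : (iter k (parent X) c <= c - k)%N.
Proof.
elim: k => [|k IHk]; first by rewrite subn0.
by rewrite iterS subnS (leq_trans (leq_div _ _))// -!subn1 leq_sub2r.
Qed.

Lemma selected_capital_nil (K : fieldType) (X : finType) S (Q : nat -> K) :
  selected_capital S Q ([::] : seq X) = 1.
Proof. by rewrite /selected_capital big_ord0. Qed.

Lemma selected_capital_rcons (K : fieldType) (X : finType) S (Q : nat -> K)
    (s : seq X) x :
  selected_capital S Q (rcons s x) = selected_capital S Q s *
    if S (situation_code s)
    then Q (situation_code (rcons s x)) / Q (situation_code s) else 1.
Proof.
rewrite /selected_capital; have := parent_rcons s x.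
have: (situation_code s < situation_code (rcons s x))%N.
  rewrite situation_code_rcons ltnS.
  by apply: leq_trans (leq_pmulr _ _) (leq_addr _ _); apply/card_gt0P; exists x.
case: (situation_code (rcons s x)) => // n; rewrite ltnS => le_sn pE.
rewrite big_ord_recl mulrC; congr (_ * _); last by rewrite /= /growth_factor pE.
under eq_bigr => k _ do rewrite lift0 iterSr pE.
rewrite -(big_mkord xpredT (fun k =>
  growth_factor X S Q (iter k (parent X) (situation_code s)))).
(* The factors from index [situation_code s] on are taken at the root, which is reached by then, and
   equal 1. *)
rewrite (big_cat_nat _ le_sn)//= [X in _ * X]big_nat.
rewrite [X in _ * X]big1 ?mulr1 ?big_mkord//.
move=> k /andP[le_sk _]; have := iter_parent X k (situation_code s).
by rewrite (eqP le_sk) leqn0 /growth_factor => /eqP ->.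
Qed.

Lemma selected_capital_gt0 (K : numFieldType) (X : finType) S (Q : nat -> K)
    (s : seq X) :
  (forall c, 0 < Q c) -> 0 < selected_capital S Q s.
Proof.
move=> Q_gt0; apply: prodr_gt0 => k _; rewrite /growth_factor.
by case: ifP => // _; rewrite divr_gt0.
Qed.

(** Each ratio of Q along the path to s goes to exactly one of the two products, so together they
    telescope. *)
Lemma selected_capitalM (K : fieldType) (X : finType) S (Q : nat -> K)
    (s : seq X) : (forall c, Q c != 0) ->
  Q (situation_code s) =
  Q 0%N * selected_capital S Q s * selected_capital (predC S) Q s.
Proof.
move=> Q_neq0; elim/last_ind: s => [|s x IHs].
  by rewrite !selected_capital_nil !mulr1.
rewrite !selected_capital_rcons /=.
rewrite -[LHS](divfK (Q_neq0 (situation_code s))) {2}IHs.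
by case: (S _) => /=; ring.
Qed.

Lemma computable_selected_capital (R : realType) (X : finType) (S : pred nat)
    N D :
  (0 < #|X|)%N -> recfun1 (fun c => S c) -> recfun1 N -> recfun1 D ->
  (forall c, 0 < N c)%N -> (forall c, 0 < D c)%N ->
  computable_process (fun s : seq X =>
    selected_capital S (fun c => (N c)%:R / (D c)%:R : R) s).
Proof.
move=> X_gt0 rS rN rD N_gt0 D_gt0.
(* The capital is [total N D] over [total D N]: exchanging N and D inverts each factor. *)
pose factor (A B : nat -> nat) c :=
  (if (0 < c) && S (parent X c) then A c * B (parent X c) else 1)%N.
pose total A B c := (\prod_(k < c) factor A B (iter k (parent X) c))%N.
have rpar : recfun1 (parent X).
  by move=> k F rF; exact: (recfun_div X_gt0 (recfun_pred rF)).
have rtotal A B : recfun1 A -> recfun1 B -> recfun1 (total A B).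
  move=> rA rB k F rF; have rfactor : recfun1 (factor A B).
    move=> l G rG; have rpG := rpar _ _ rG.
    apply: recfun_if; [|exact: (recfun_mul (rA _ _ rG) (rB _ _ rpG))|].
      apply: recfun_ext (recfun_mul (recfun_leq (recfun_cst l 1) rG)
        (rS _ _ rpG)) => v.
      by rewrite mulnb.
    exact: recfun_cst.
  have riter : recfun2 (fun n c => factor A B (iter n (parent X) c)).
    by move=> l G H rG rH; apply/rfactor/(recfun_iter rpar).
  exact: (recfun_prod riter rF rF).
have total_gt0 A B c : (forall n, 0 < A n)%N -> (forall n, 0 < B n)%N ->
    (0 < total A B c)%N.
  move=> A0 B0; apply: prodn_gt0 => k; rewrite /factor.
  by case: ifP; rewrite // muln_gt0 A0 B0.
have := computable_process_ratio R X (rtotal _ _ rN rD) (rtotal _ _ rD rN)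
  (fun c => total_gt0 _ _ c D_gt0 N_gt0).
congr computable_process; apply: funext => s.
rewrite /selected_capital /total !natr_prod -prodfV -big_split /=.
apply: eq_bigr => k _; rewrite /growth_factor /factor.
case: ifP => _; last by rewrite invr1 mulr1.
rewrite !natrM; field.
by rewrite !pnatr_eq0 -!lt0n !N_gt0 !D_gt0.
Qed.

(** * Coherent expectations *)

Lemma range_min (R : realType) (X : finType) (g : X -> R) :
  (0 < #|X|)%N -> exists x, forall y, g x <= g y.
Proof.
move=> /card_gt0P[x0 _]; exists [arg min_(x < x0) g x]%O.
by case: arg_minP => // x _ gx y; exact: gx.
Qed.

Lemma inf_range_ge (R : realType) (X : finType) (g : X -> R) c :
  (0 < #|X|)%N -> (forall x, c <= g x) -> c <= inf (range g).
Proof.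
move=> /card_gt0P[x0 _] cg; apply: lb_le_inf; first by exists (g x0), x0.
by move=> _ [x _ <-].
Qed.

Lemma inf_range_le (R : realType) (X : finType) (g : X -> R) x :
  inf (range g) <= g x.
Proof.
have X_gt0 : (0 < #|X|)%N by apply/card_gt0P; exists x.
have [y gy] := range_min g X_gt0.
by apply: ge_inf; [exists (g y) => _ [z _ <-] | exists x].
Qed.

Lemma coherent_ge (R : realType) (X : finType) (E : (X -> R) -> R) g c :
  (0 < #|X|)%N -> coherent E -> (forall x, c <= g x) -> c <= E g.
Proof.
move=> X_gt0 cE cg; apply: le_trans (coherent_min cE g).
exact: inf_range_ge.
Qed.

(** Used for f and for -f, to find outcomes with f xa <= a and b <= f xb. *)
Lemma coherent_attains (R : realType) (X : finType) (E : (X -> R) -> R) g :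
  (0 < #|X|)%N -> coherent E -> exists x, g x <= E g.
Proof.
move=> X_gt0 cE; have [x gx] := range_min g X_gt0.
by exists x; exact: coherent_ge.
Qed.

Lemma upper_expectationN (R : realType) (X : finType) (E : (X -> R) -> R) g :
  upper_expectation E (fun x => - g x) = - E g.
Proof. by rewrite /upper_expectation; under eq_fun do rewrite opprK. Qed.

Lemma upper_expectationZ (R : realType) (X : finType) (E : (X -> R) -> R) g
    (k : R) : coherent E -> 0 <= k ->
  upper_expectation E (fun x => k * g x) = k * upper_expectation E g.
Proof.
move=> cE k0; rewrite /upper_expectation mulrN -(coherent_homogeneous cE)//.
by under eq_fun do rewrite -mulrN.
Qed.

Lemma upper_expectation_le (R : realType) (X : finType) (E : (X -> R) -> R)
    g h e : (0 < #|X|)%N -> coherent E -> (forall x, g x <= h x + e) ->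
  upper_expectation E g <= upper_expectation E h + e.
Proof.
move=> X_gt0 cE gh; rewrite /upper_expectation.
have := coherent_superadditive cE (fun x => - h x) (fun x => h x - g x).
under [X in E _ + E _ <= E X]eq_fun do rewrite addKr.
have : - e <= E (fun x => h x - g x).
  by apply: coherent_ge => // x; have := gh x; lra.
by lra.
Qed.

(** The dominating gamble has upper expectation at most e, by homogeneity; e is arbitrary. *)
Lemma upper_expectation_le0 (R : realType) (X : finType) (E : (X -> R) -> R)
    (g h : X -> R) : (0 < #|X|)%N -> coherent E ->
  (forall e, 0 < e -> exists2 k, 0 <= k &
    forall x, g x <= k * (h x - upper_expectation E h) + e) ->
  upper_expectation E g <= 0.
Proof.
move=> X_gt0 cE gh; apply/ler_addgt0Pr => e /gh[k k0 {}gh]; rewrite add0r.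
rewrite -(subrKC (upper_expectation E (fun x => k * h x)) e).
apply: upper_expectation_le => // x.
by rewrite upper_expectationZ//; have := gh x; lra.
Qed.

(* The natural extension of the assessments [a <= E f] and [E f <= b]. *)
Definition bounded_expectation (R : realType) (X : finType) (f : X -> R)
    (a b : R) (g : X -> R) : R :=
  sup [set c | exists l m, [/\ 0 <= l, 0 <= m &
    forall x, c + l * (f x - a) + m * (b - f x) <= g x]].

(** The supremum is genuine because no stakes l', m' yield a sure gain: at xa if l' <= m', at xb
    otherwise, their total payoff is at least min(l', m') * (b - a) >= 0. *)
Lemma bounded_expectation_ge (R : realType) (X : finType) (f : X -> R)
    a b xa xb g l m c :
  f xa <= a -> a <= b -> b <= f xb -> 0 <= l -> 0 <= m ->
  (forall x, c + l * (f x - a) + m * (b - f x) <= g x) ->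
  c <= bounded_expectation f a b g.
Proof.
move=> fxa ab fxb l0 m0 cg; apply: ub_le_sup; last by exists l, m.
exists (Num.max (g xa) (g xb)) => d [l' [m' [l'0 m'0 dg]]].
rewrite le_max; case: (leP l' m') => lm; apply/orP; [left|right].
  by apply: le_trans (dg xa); nra.
by apply: le_trans (dg xb); nra.
Qed.

Lemma bounded_expectation_le (R : realType) (X : finType) (f : X -> R)
    a b g u : (0 < #|X|)%N ->
  (forall l m c, 0 <= l -> 0 <= m ->
    (forall x, c + l * (f x - a) + m * (b - f x) <= g x) -> c <= u) ->
  bounded_expectation f a b g <= u.
Proof.
move=> X_gt0 gu; apply: ge_sup; last by move=> c [l [m [l0 m0 /gu]]]; exact.
have [x gx] := range_min g X_gt0.
by exists (g x), 0, 0; split=> // y; rewrite !mul0r !addr0.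
Qed.

Lemma bounded_expectation_coherent (R : realType) (X : finType) (f : X -> R)
    a b xa xb :
  f xa <= a -> a <= b -> b <= f xb -> coherent (bounded_expectation f a b).
Proof.
move=> fxa ab fxb.
have X_gt0 : (0 < #|X|)%N by apply/card_gt0P; exists xa.
have ge := bounded_expectation_ge fxa ab fxb.
(* Half of homogeneity; the other half is this one for k^-1 and the gamble k * g. *)
have scale g k : 0 < k -> k * bounded_expectation f a b g <=
    bounded_expectation f a b (fun x => k * g x).
  move=> k0; rewrite -ler_pdivlMl//; apply: bounded_expectation_le => // l m c.
  move=> l0 m0 cg; rewrite ler_pdivlMl//.
  apply: (ge _ (k * l) (k * m)); rewrite ?mulr_ge0 ?(ltW k0)// => x.
  by rewrite -!mulrA -!mulrDr ler_pM2l.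
split=> [g|g k|g h].
- apply: (ge _ 0 0) => // x; rewrite !mul0r !addr0; exact: inf_range_le.
- rewrite le_eqVlt => /predU1P[<-|k0].
    rewrite mul0r; apply/le_anti/andP; split; last first.
      by apply: (ge _ 0 0) => // x; rewrite !mul0r !addr0.
    apply: bounded_expectation_le => // l m c l0 m0 cg.
    have := cg xa; have := cg xb; rewrite !mul0r.
    by case: (leP l m) => lm; nra.
  apply/le_anti; rewrite scale// andbT.
  rewrite -ler_pdivrMl//; apply: le_trans (scale _ _ _) _; first by rewrite invr_gt0.
  by under eq_fun do rewrite mulKf ?gt_eqF//.
- rewrite -lerBrDr; apply: bounded_expectation_le => // l m c l0 m0 cg.
  rewrite lerBrDr -lerBrDl; apply: bounded_expectation_le => // l' m' c' l'0 m'0 ch.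
  rewrite lerBrDl; apply: (ge _ (l + l') (m + m')); rewrite ?addr_ge0// => x.
  by have := cg x; have := ch x; lra.
Qed.

(** A unit stake on one assessment attains each bound. That no stakes do better is seen at xa or xb,
    according to whether the net stake exceeds 1. *)
Lemma bounded_expectationE (R : realType) (X : finType) (f : X -> R)
    a b xa xb :
  f xa <= a -> a <= b -> b <= f xb ->
  bounded_expectation f a b f = a /\
  upper_expectation (bounded_expectation f a b) f = b.
Proof.
move=> fxa ab fxb.
have X_gt0 : (0 < #|X|)%N by apply/card_gt0P; exists xa.
have ge := bounded_expectation_ge fxa ab fxb.
split; last rewrite /upper_expectation -[RHS]opprK; first 1 last.
- congr (- _).
  apply/le_anti/andP; split.
    apply: bounded_expectation_le => // l m c l0 m0 cf.
    have := cf xa; have := cf xb.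
    by case: (leP (m - l) 1) => ml; nra.
  by apply: (ge _ 0 1) => // x; rewrite mul0r; lra.
- apply/le_anti/andP; split.
    apply: bounded_expectation_le => // l m c l0 m0 cf.
    have := cf xa; have := cf xb.
    by case: (leP (l - m) 1) => ml; nra.
  by apply: (ge _ 1 0) => // x; rewrite mul0r; lra.
Qed.

Lemma upper_bounded_expectation_le0 (R : realType) (X : finType) (f : X -> R)
    a b E1 E2 g :
  (0 < #|X|)%N -> coherent E1 -> coherent E2 ->
  E1 f = a -> upper_expectation E2 f = b -> a <= b ->
  upper_expectation (bounded_expectation f a b) g <= 0 ->
  if [exists x, (b < f x) && (0 < g x)] then upper_expectation E2 g <= 0
  else upper_expectation E1 g <= 0.
Proof.
move=> X_gt0 cE1 cE2 E1f E2f ab; rewrite oppr_le0 => g0.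
(* Otherwise every c admissible for -g is at most -e, and the lower expectation of -g would be
   negative. *)
have approx e : 0 < e -> exists l m, [/\ 0 <= l, 0 <= m &
    forall x, g x <= l * (a - f x) + m * (f x - b) + e].
  move=> e0; apply: contrapT => no_lm.
  suff : bounded_expectation f a b (fun x => - g x) <= - e by lra.
  apply: bounded_expectation_le => // l m c l0 m0 cg.
  case: (leP c (- e)) => // ec; exfalso; apply: no_lm.
  by exists l, m; split=> // x; have := cg x; lra.
case: ifPn => [/existsP[y /andP[by_ gy]]|/existsPn gb].
  apply: (upper_expectation_le0 (h := f)) => // e e0.
  (* An error of at most g y / 2 forces l < m: for m <= l the payoff of the stakes at y is at most
     0, as f y > b >= a. *)
  have [|l [m [l0 m0 lm]]] := approx (Num.min e (g y / 2)).
    by rewrite lt_min e0 divr_gt0.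
  have le_e : Num.min e (g y / 2) <= e by rewrite ge_min lexx.
  have le_g : Num.min e (g y / 2) <= g y / 2 by rewrite ge_min lexx orbT.
  have {}lt_lm : l < m.
    by rewrite ltNge; apply/negP => le_ml; have := lm y; nra.
  (* l * (a - f) + m * (f - b) is (m - l) * (f - b) minus the non-negative term l * (b - a). *)
  by exists (m - l) => [|x]; [lra | rewrite E2f; have := lm x; nra].
apply: (upper_expectation_le0 (h := fun x => - f x)) => // e e0.
have [l [m [l0 m0 lm]]] := approx e e0.
case: (leP m l) => [le_ml|/ltW le_lm].
  exists (l - m) => [|x]; first by lra.
  by rewrite upper_expectationN E1f; have := lm x; nra.
(* With l <= m the stakes pay at most 0 where f x <= b; elsewhere the failed test gives g x <= 0. *)
exists 0 => // x; rewrite mul0r add0r.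
have [fx|fx] := leP (f x) b; first by have := lm x; nra.
by have := gb x; rewrite fx /= -leNgt; lra.
Qed.

(** * Randomness *)

(** At s the increment is a non-negative multiple of that of Q: the ratio of the two capitals if S
    selects s, 0 otherwise. *)
Lemma selected_capital_supermartingale (R : realType) (X : finType)
    (E : (X -> R) -> R) (S : pred nat) (Q : nat -> R) (s : seq X) :
  coherent E -> (forall c, 0 < Q c) ->
  (S (situation_code s) ->
    upper_expectation E (process_difference (Q \o @situation_code X) s) <= 0) ->
  upper_expectation E (process_difference (selected_capital S Q) s) <= 0.
Proof.
move=> cE Q_gt0 Q_super; pose k : R :=
  if S (situation_code s) then selected_capital S Q s / Q (situation_code s)
  else 0.
rewrite (_ : process_difference (selected_capital S Q) s = fun x =>
  k * process_difference (Q \o @situation_code X) s x); last first.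
  apply/funext => x; rewrite /process_difference selected_capital_rcons /k /=.
  case: (S _); last by rewrite mulr1 subrr mul0r.
  by field; rewrite gt_eqF.
have k_ge0 : 0 <= k.
  by rewrite /k; case: ifP => // _; rewrite divr_ge0 ?ltW ?selected_capital_gt0.
rewrite upper_expectationZ//; move: Q_super; rewrite /k.
case: (S _) => [/(_ isT) Q_super|_]; last by rewrite mul0r.
by rewrite mulr_ge0_le0// divr_ge0 ?ltW ?selected_capital_gt0.
Qed.

Lemma computably_random_bounded (R : realType) (X : finType)
    (E : (X -> R) -> R) (w : nat -> X) (M : seq X -> R) :
  computably_random E w -> computable_process M -> (forall s, 0 <= M s) ->
  (forall s, upper_expectation E (process_difference M s) <= 0) ->
  exists B, forall n, M (mkseq w n) <= B.
Proof.
move=> rw cM M_ge0 M_super; apply: contrapT => unbounded; apply: rw.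
exists M; split=> //; apply/eqP; rewrite -leye_eq leNgt; apply/negP => sup_lt.
have sup_ge n : ((M (mkseq w n))%:E <= ereal_sup (range
    (fun n => (M (mkseq w n))%:E)))%E by apply: ereal_sup_ubound; exists n.
move: sup_lt sup_ge; case: ereal_sup => [B _ sup_ge|//|_ /(_ 0%N)] //.
by apply: unbounded; exists B => n; rewrite -lee_fin.
Qed.

Lemma computably_random_bounded_expectation (R : realType) (X : finType)
    (w : nat -> X) (f : X -> R) a b E1 E2 :
  (0 < #|X|)%N -> a <= b ->
  coherent E1 -> computably_random E1 w -> E1 f = a ->
  coherent E2 -> computably_random E2 w -> upper_expectation E2 f = b ->
  computably_random (bounded_expectation f a b) w.
Proof.
move=> X_gt0 ab cE1 rE1 E1f cE2 rE2 E2f [M [cM M_ge0 M_super supM]].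
have [xa fxa] : exists x, f x <= a by rewrite -E1f; exact: coherent_attains.
have [xb fxb] : exists x, b <= f x.
  have [x fx] := coherent_attains (fun x => - f x) X_gt0 cE2.
  by exists x; rewrite -E2f lerNl.
have cE := bounded_expectation_coherent fxa ab fxb.
have [N [D [rN rD D_gt0 ND]]] := rational_majorant X_gt0 cM M_ge0.
have p2_gt0 n : 0 < 2 ^- n :> R by rewrite invr_gt0 exprn_gt0.
pose Q c : R := (N c)%:R / (D c)%:R.
have N_gt0 c : (0 < N c)%N.
  have [s sc] := situation_code_surj X_gt0 c.
  have /andP[+ _] := ND _ _ (esym sc); rewrite lt0n; case: eqP => // ->.
  by rewrite mul0r; have := p2_gt0 c; have := M_ge0 s; lra.
have Q_gt0 c : 0 < Q c by rewrite divr_gt0 ?ltr0n.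
pose MQ := Q \o @situation_code X.
(* The increments of [MQ] are at most those of M: the margin at sx is at most 2 * 2^-c(sx) <=
   2^-c(s), a lower bound for the margin at s. *)
have MQ_super s :
    upper_expectation (bounded_expectation f a b) (process_difference MQ s) <= 0.
  apply: le_trans (M_super s); rewrite -[leRHS]addr0.
  apply: upper_expectation_le => // x; rewrite addr0 /process_difference.
  have /andP[lo _] := ND s _ erefl; have /andP[_ hi] := ND (rcons s x) _ erefl.
  have : 2 * 2 ^- situation_code (rcons s x) <= 2 ^- situation_code s :> R.
    rewrite -ler_pdivlMl// -invfM -exprS lef_pV2 ?posrE ?exprn_gt0//.
    rewrite ler_eXn2l ?ltr1n// situation_code_rcons ltnS.
    by apply: leq_trans (leq_pmulr _ _) (leq_addr _ _).
  by move: lo hi; rewrite /MQ /= /Q; lra.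
pose child c x := (c * #|X| + @enum_rank X x).+1.
(* The inequality Q c < Q (child c x), cleared of denominators to compare natural numbers. *)
pose S c := has (fun x => N c * D (child c x) < N (child c x) * D c)%N
  [seq x <- enum X | b < f x].
have rS : recfun1 (fun c => S c).
  apply: (recfun_has (P := fun x c => N c * D (child c x) < _)%N) => x k F rF.
  have rC : recfun k (fun v => child (F v) x).
    apply/recfun_succ/recfun_add; last exact: recfun_cst.
    by apply: recfun_mul => //; exact: recfun_cst.
  apply: recfun_leq; first apply: recfun_succ; apply: recfun_mul.
  - exact: rN.
  - exact: rD.
  - exact: rN.
  - exact: rD.
have SE s : S (situation_code s) =
    [exists x, (b < f x) && (0 < process_difference MQ s x)].
  have ratE x : (N (situation_code s) * D (child (situation_code s) x) <
      N (child (situation_code s) x) * D (situation_code s))%N =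
      (0 < process_difference MQ s x).
    rewrite /process_difference subr_gt0 /MQ /= /Q situation_code_rcons.
    by rewrite ltr_pdivrMr ?ltr0n// mulrAC ltr_pdivlMr ?ltr0n// -!natrM ltr_nat.
  apply/hasP/existsP => [[x]|[x /andP[bx gx]]].
    by rewrite mem_filter ratE => /andP[bx _] gx; exists x; rewrite bx.
  by exists x; rewrite ?ratE// mem_filter bx mem_enum.
have split_super s := upper_bounded_expectation_le0 X_gt0 cE1 cE2 E1f E2f ab
  (MQ_super s).
have rnS : recfun1 (fun c => predC S c).
  move=> k F rF; apply: recfun_ext (recfun_sub (recfun_cst k 1) (rS _ _ rF)) => v.
  by rewrite /=; case: (S _).
have [B2 B2P] : exists B, forall n, selected_capital S Q (mkseq w n) <= B.
  apply: computably_random_bounded rE2 _ _ _ => [|s|s].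
  - exact: computable_selected_capital.
  - exact/ltW/selected_capital_gt0.
  - apply: selected_capital_supermartingale => // Ss.
    by have := split_super s; rewrite -SE Ss.
have [B1 B1P] : exists B, forall n, selected_capital (predC S) Q (mkseq w n) <= B.
  apply: computably_random_bounded rE1 _ _ _ => [|s|s].
  - exact: computable_selected_capital.
  - exact/ltW/selected_capital_gt0.
  - apply: selected_capital_supermartingale => // /negPf Ss.
    by have := split_super s; rewrite -SE Ss.
suff : (ereal_sup (range (fun n => (M (mkseq w n))%:E)) <= (Q 0%N * B2 * B1)%:E)%E.
  by rewrite supM leye_eq.
apply: ge_ereal_sup => _ [n _ <-]; rewrite lee_fin.
have Q_neq0 c : Q c != 0 by rewrite gt_eqF.
apply: (@le_trans _ _ (Q (situation_code (mkseq w n)))).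
  have /andP[+ _] := ND (mkseq w n) _ erefl.
  by apply: le_trans; rewrite lerDl ltW.
rewrite (selected_capitalM S _ Q_neq0) ler_pM// ?ler_pM2l//.
- by rewrite mulr_ge0 ?ltW ?selected_capital_gt0.
- by rewrite ltW ?selected_capital_gt0.
Qed.

Theorem proposition19 (R : realType) (X : finType) (X_nonempty : (0 < #|X|)%N)
    (w : nat -> X) (f : X -> R) (I : closed_interval R) :
  I \in random_intervals f w <->
  imin I \in L_ f w /\ imax I \in U_ f w.
Proof.
split=> [Iw|[/set_mem[J1 [E1 [cE1 rE1 E1f _]] minJ1]]].
  by split; apply/mem_set; exists I => //; exact: set_mem.
move=> /set_mem[J2 [E2 [cE2 rE2 _ E2f]] maxJ2]; apply/mem_set.
rewrite minJ1 in E1f; rewrite maxJ2 in E2f.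
(* The bounds come from different expectations, but each is compatible with the range of f, so the
   natural extension attains both. *)
have [xa fxa] : exists x, f x <= imin I by rewrite -E1f; exact: coherent_attains.
have [xb fxb] : exists x, imax I <= f x.
  have [x fx] := coherent_attains (fun x => - f x) X_nonempty cE2.
  by exists x; rewrite -E2f lerNl.
have ab := imin_le_imax I.
have [Ef uEf] := bounded_expectationE fxa ab fxb.
exists (bounded_expectation f (imin I) (imax I)); split=> //.
- exact: bounded_expectation_coherent fxa ab fxb.
- exact: computably_random_bounded_expectation cE1 rE1 E1f cE2 rE2 E2f.
Qed.
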